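(* Let $n\ge0$ be an integer and let $S_n=F_nU_n^{-1}$, a linear operator on the space $\mathcal P_n$ of complex polynomials of degree at most $n$. Then for every $p=0,1,\dots,n$, $$S_nx^p=\frac{(n+p)!\,(n-p)!}{n!}\sum_{m=p}^{n}\binom{n}{m-p}\binom{n}{n-m}x^m .$$
   Context: The Euler polynomials $A_k(x)$ are defined by $\frac{A_k(x)}{(1-x)^{k+1}}=\sum_{m\ge0}m^kx^m$, with $A_0=1$. Linear operators on $\mathcal P_n$ are given on monomials $x^p$, $p=0,\dots,n$: $U_n x^p=\frac1{n!}(1-x)^{n-p}A_p(x)=(1-x)^{n+1}\frac1{n!}\sum_{m\ge0}m^px^m$ (invertible, with $U_n^{-1}x^p=(x)_p[x+1]_{n-p}$, where $(\varphi)_k=\varphi(\varphi-1)\cdots(\varphi-k+1)$, $[\varphi]_k=\varphi(\varphi+1)\cdots(\varphi+k-1)$, both $=1$ for $k=0$); $F_n x^p=(1-x)^{2n+1}\sum_{m\ge0}m^p\binom{m+n}{n}x^m$ (a polynomial of degree $\le n$; $0^0=1$). *)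

(* Defs.v *)
From HB Require Import structures.
From mathcomp Require Import all_boot all_order all_algebra.
From mathcomp Require Import complex reals.
Set Implicit Arguments.
Unset Strict Implicit.
Unset Printing Implicit Defensive.
Import Order.TTheory GRing.Theory Num.Theory.
Local Open Scope ring_scope.

(* A formal power series \sum_m f_m x^m is its coefficient sequence
   f : nat -> K; [pmul q f] is the (Cauchy) product q(x) * \sum_m f_m x^m. *)
Definition pmul (K : nzRingType) (q : {poly K}) (f : nat -> K) (j : nat) : K :=
  \sum_(i < j.+1) q`_i * f (j - i)%N.

Section Series.
Variable K : comNzRingType.
Implicit Types (p q g : {poly K}) (f h : nat -> K).

Lemma pmul_trunc q f j N :
  (j < N)%N -> pmul q f j = (q * \poly_(i < N) f i)`_j.
Proof.
move=> jN; rewrite coefM; apply: eq_bigr => i _.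
by rewrite coef_poly (leq_ltn_trans (leq_subr _ _) jN).
Qed.

Lemma eq_pmul q f h j :
  (forall i, (i <= j)%N -> f i = h i) -> pmul q f j = pmul q h j.
Proof. by move=> fh; apply: eq_bigr => i _; rewrite fh ?leq_subr. Qed.

Lemma pmulA p q f j : pmul (p * q) f j = pmul p (pmul q f) j.
Proof.
rewrite (@pmul_trunc _ _ _ j.+1) // -mulrA coefM; apply: eq_bigr => i _.
by rewrite -pmul_trunc // ltnS leq_subr.
Qed.

Lemma pmul1 f j : pmul 1 f j = f j.
Proof. by rewrite (@pmul_trunc _ _ _ j.+1) // mul1r coef_poly ltnSn. Qed.

Lemma pmulXn n f j : pmul 'X^n f (j + n) = f j.
Proof.
rewrite (@pmul_trunc _ _ _ (j + n).+1) // coefXnM ltnNge leq_addl /= addnK.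
by rewrite coef_poly ltnS leq_addr.
Qed.

Lemma pmulXn_lt n f j : (j < n)%N -> pmul 'X^n f j = 0.
Proof. by move=> jn; rewrite (@pmul_trunc _ _ _ j.+1) // coefXnM jn. Qed.

Lemma pmulBX f j : pmul (1 - 'X) f j.+1 = f j.+1 - f j.
Proof.
rewrite (@pmul_trunc _ _ _ j.+2) // mulrBl mul1r coefB mulrC coefMX /=.
by rewrite !coef_poly ltnSn ltnS leqnSn.
Qed.

Lemma size_fdiff g d :
  (size g <= d.+1)%N -> (size (g - (g \Po ('X - 1%:P)))%R <= d)%N.
Proof.
elim: d g => [|d IHd] g sg.
  by rewrite (size1_polyC sg) comp_polyC subrr size_poly0.
have [c ->] : exists c, g = (drop_poly 1 g) * 'X + c%:P.
  exists g`_0; rewrite -[LHS](poly_take_drop 1) addrC expr1; congr (_ + _).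
  by apply/polyP => i; rewrite coef_take_poly coefC; case: i.
set h := drop_poly 1 g.
have sh : (size h <= d.+1)%N by rewrite size_drop_poly leq_subLR add1n.
rewrite comp_polyD comp_polyM comp_polyX comp_polyC opprD addrACA subrr addr0.
have -> : h * 'X - (h \Po ('X - 1%:P)) * ('X - 1%:P) =
          (h - (h \Po ('X - 1%:P))) * 'X + (h \Po ('X - 1%:P)).
  by rewrite mulrBr mulr1 mulrBl opprB addrA addrAC.
apply: (leq_trans (size_polyD _ _)); rewrite geq_max; apply/andP; split.
  apply: (leq_trans (size_polyMleq _ _)).
  by rewrite size_polyX addn2 /= ltnS IHd.
apply: (leq_trans (size_comp_poly_leq _ _)).
rewrite size_XsubC muln1 ltnS.
by case: (size h) sh.
Qed.

Lemma pmul_vanish d m g f :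
    (size g <= d)%N -> (forall j, (m <= j)%N -> f j = g.[j%:R]) ->
  forall j, (m + d <= j)%N -> pmul ((1 - 'X) ^+ d) f j = 0.
Proof.
elim: d m g f => [|d IHd] m g f sg fg j.
  rewrite addn0 expr0 pmul1 => /fg ->; move: sg.
  by rewrite size_poly_leq0 => /eqP ->; rewrite horner0.
rewrite addnS -addSn => jmd; rewrite exprSr pmulA.
apply: (IHd m.+1 (g - (g \Po ('X - 1%:P)))) => //; first exact: size_fdiff.
case=> // i mi; rewrite pmulBX (fg i.+1) 1?ltnW // (fg i) //.
by rewrite hornerD hornerN horner_comp !hornerE -natr1 addrK.
Qed.

End Series.

Section Operators.
Variable K : numFieldType.

(* The Euler polynomial A_k is (1-x)^(k+1) * \sum_m m^k x^m; cutting the series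
   after x^k loses nothing, see [eulerE].  Note that 0 ^+ 0 = 1. *)
Definition euler (k : nat) : {poly K} :=
  \poly_(i < k.+1) pmul ((1 - 'X) ^+ k.+1) (fun m => m%:R ^+ k) i.

Lemma eulerE k i :
  (euler k)`_i = pmul ((1 - 'X) ^+ k.+1) (fun m => m%:R ^+ k) i.
Proof.
rewrite coef_poly; case: ltnP => // ki; apply/esym.
apply: (@pmul_vanish _ _ 0%N 'X^k) => //; first by rewrite size_polyXn.
by move=> j _; rewrite hornerXn.
Qed.

Lemma euler0 : euler 0 = 1.
Proof.
apply/polyP => i; rewrite coef_poly coef1.
case: i => [|i] //=.
by rewrite /pmul big_ord1 /= expr1 coefB coef1 coefX subr0 mulr1.
Qed.

Local Notation "''nX^' i" := (tnth (npolyX _ _) i) : ring_scope.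

(* The space P_n of polynomials of degree <= n is {poly_n.+1 K} (bounded size);
   [monomial_lin f] is the operator on it sending x^p to f p. *)
Definition monomial_fun (n : nat) (f : 'I_n.+1 -> {poly_n.+1 K})
    (q : {poly_n.+1 K}) : {poly_n.+1 K} := \sum_(p < n.+1) q`_p *: f p.

Lemma monomial_fun_is_linear n (f : 'I_n.+1 -> {poly_n.+1 K}) :
  linear (monomial_fun f).
Proof.
move=> a u v; rewrite /monomial_fun scaler_sumr -big_split /=.
by apply: eq_bigr => i _; rewrite coefD coefZ scalerDl scalerA.
Qed.

HB.instance Definition _ n (f : 'I_n.+1 -> {poly_n.+1 K}) :=
  GRing.isLinear.Build K {poly_n.+1 K} {poly_n.+1 K} _ (monomial_fun f)
    (monomial_fun_is_linear f).

Definition monomial_lin (n : nat) (f : 'I_n.+1 -> {poly_n.+1 K}) :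
  'End({poly_n.+1 K}) := linfun (monomial_fun f).

Lemma monomial_linE n (f : 'I_n.+1 -> {poly_n.+1 K}) q :
  monomial_lin f q = \sum_(p < n.+1) q`_p *: f p.
Proof. by rewrite lfunE. Qed.

Lemma monomial_linX n (f : 'I_n.+1 -> {poly_n.+1 K}) p :
  monomial_lin f 'nX^p = f p.
Proof.
rewrite monomial_linE (bigD1 p) //= npolyXE coefXn eqxx scale1r.
rewrite big1 ?addr0 // => i; rewrite -val_eqE /= => neq_ip.
by rewrite coefXn (negPf neq_ip) scale0r.
Qed.

(* U_n x^p = (1-x)^(n-p) A_p(x) / n!; the degree is at most n, so that [npolyp]
   cuts nothing off, see [UopX]. *)
Definition Uop (n : nat) : 'End({poly_n.+1 K}) :=
  monomial_lin (fun p : 'I_n.+1 =>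
    npolyp n.+1 ((n`!%:R)^-1 *: ((1 - 'X) ^+ (n - p) * euler p))).

Lemma UopX n (p : 'I_n.+1) :
  Uop n 'nX^p = (n`!%:R)^-1 *: ((1 - 'X) ^+ (n - p) * euler p) :> {poly K}.
Proof.
rewrite monomial_linX npolypK //.
apply: (leq_trans (size_scale_leq _ _)).
apply: (leq_trans (size_polyMleq _ _)).
have s1 : (size ((1 - 'X : {poly K}) ^+ (n - p)) <= (n - p).+1)%N.
  apply: (leq_trans (size_poly_exp_leq _ _)); rewrite ltnS.
  by rewrite -opprB size_polyN size_XsubC mul1n.
have s2 : (size (euler p) <= p.+1)%N by exact: size_poly.
have pn : (p <= n)%N by rewrite -ltnS ltn_ord.
by move: (leq_add s1 s2); rewrite addSn addnS subnK // -subn1 leq_subLR add1n.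
Qed.

Lemma UopE n (q : {poly_n.+1 K}) i :
  (Uop n q)`_i =
  (n`!%:R)^-1 * pmul ((1 - 'X) ^+ n.+1) (fun m => q.[m%:R]) i.
Proof.
rewrite /Uop monomial_linE coefn_sum.
have UX (p : 'I_n.+1) : (Uop n 'nX^p)`_i =
    (n`!%:R)^-1 * pmul ((1 - 'X) ^+ n.+1) (fun m => m%:R ^+ p) i.
  rewrite UopX coefZ; congr (_ * _).
  have pn : (p <= n)%N by rewrite -ltnS ltn_ord.
  have -> : (1 - 'X : {poly K}) ^+ n.+1 = (1 - 'X) ^+ (n - p) * (1 - 'X) ^+ p.+1.
    by rewrite -exprD addnS subnK.
  rewrite pmulA coefM; apply: eq_bigr => j _.
  by rewrite eulerE.
transitivity (\sum_(p < n.+1) q`_p * ((n`!%:R)^-1 *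
    pmul ((1 - 'X) ^+ n.+1) (fun m => m%:R ^+ p) i)).
  by apply: eq_bigr => p _; rewrite coefZ -UX /Uop monomial_linX.
rewrite /pmul mulr_sumr.
under eq_bigr => p _ do rewrite !mulr_sumr.
rewrite exchange_big /=; apply: eq_bigr => j _.
rewrite (horner_coef_wide _ (size_npoly q)) !mulr_sumr.
by apply: eq_bigr => p _; rewrite mulrCA; congr (_ * _); rewrite mulrCA.
Qed.

(* U_n is invertible, so that (Uop n)^-1%VF is its two-sided inverse. *)
Lemma lker_Uop n : lker (Uop n) == 0%VS.
Proof.
rewrite -subv0; apply/subvP => q; rewrite memv_ker memv0 => /eqP Uq0.
have inj1 (f : nat -> K) :
    (forall j, pmul (1 - 'X) f j = 0) -> forall j, f j = 0.
  move=> f0; elim=> [|j IHj].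
    have := f0 0%N; rewrite /pmul big_ord1 /=.
    by rewrite coefB coef1 coefX subr0 mul1r.
  by have := f0 j.+1; rewrite pmulBX IHj subr0.
have injn d (f : nat -> K) :
    (forall j, pmul ((1 - 'X) ^+ d) f j = 0) -> forall j, f j = 0.
  elim: d f => [|d IHd] f f0; first by move=> j; rewrite -[RHS](f0 j) pmul1.
  by apply: inj1; apply: IHd => j; rewrite -pmulA -exprSr.
have q0 : forall m : nat, q.[m%:R] = 0.
  apply: (injn n.+1) => j; have := UopE q j.
  rewrite Uq0 coef0 => /esym/eqP; rewrite mulf_eq0 invr_eq0 pnatr_eq0.
  by rewrite (gtn_eqF (fact_gt0 n)) => /eqP.
apply/eqP/val_inj => /=.
apply: (@roots_geq_poly_eq0 _ _ [seq m%:R | m <- iota 0 n.+1]).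
- by apply/allP => _ /mapP[m _ ->]; apply/eqP.
- rewrite map_inj_in_uniq ?iota_uniq // => a b _ _ /eqP.
  by rewrite eqr_nat => /eqP.
- by rewrite size_map size_iota size_npoly.
Qed.

(* F_n x^p = (1-x)^(2n+1) * \sum_m m^p binom(m+n, n) x^m; cutting the series
   after x^n loses nothing, see [FopX]. *)
Definition Fop (n : nat) : 'End({poly_n.+1 K}) :=
  monomial_lin (fun p : 'I_n.+1 =>
    mk_npoly n.+1 (pmul ((1 - 'X) ^+ (2 * n).+1)
                        (fun m => m%:R ^+ p * 'C(m + n, n)%:R))).

Lemma FopX n (p : 'I_n.+1) i :
  (Fop n 'nX^p)`_i =
  pmul ((1 - 'X) ^+ (2 * n).+1) (fun m => m%:R ^+ p * 'C(m + n, n)%:R) i.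
Proof.
rewrite monomial_linX /= coef_poly; case: ltnP => // ni; apply/esym.
set f := fun m => _.
pose g : {poly K} :=
  (n`!%:R)^-1 *: (('X - n%:R%:P) ^+ p * \prod_(k < n) ('X - k%:R%:P)).
rewrite -(pmulXn n (pmul _ f)) -pmulA mulrC pmulA.
apply: (@pmul_vanish _ _ 0%N g); last by rewrite add0n mul2n -addnn -addSn leq_add2r.
  apply: (leq_trans (size_scale_leq _ _)).
  apply: (leq_trans (size_polyMleq _ _)).
  rewrite size_exp_XsubC size_prod_XsubC /=.
  rewrite -[index_enum _]enumT size_enum_ord addnS ltnS.
  by rewrite mul2n -addnn leq_add2r -ltnS ltn_ord.
move=> j _; rewrite /g hornerZ hornerM horner_exp horner_prod !hornerXsubC.
under eq_bigr => k _ do rewrite hornerXsubC.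
have prodE : \prod_(k < n) (j%:R - k%:R : K) = (j ^_ n)%:R.
  have [jn|nj] := ltnP j n.
    rewrite ffact_small // (bigD1 (Ordinal jn)) //= subrr mul0r //.
  rewrite ffact_prod natr_prod; apply: eq_bigr => k _.
  by rewrite natrB // (leq_trans _ nj) // ltnW.
rewrite prodE -bin_ffact natrM.
have [jn|nj] := ltnP j n.
  by rewrite pmulXn_lt // bin_small // mul0r !mulr0.
rewrite -(subnK nj) pmulXn /f natrD addrK.
rewrite [RHS]mulrC -!mulrA mulfV ?mulr1 //.
by rewrite pnatr_eq0 -lt0n fact_gt0.
Qed.

Definition Sop (n : nat) : 'End({poly_n.+1 K}) := (Fop n \o (Uop n)^-1)%VF.

End Operators.

Arguments Uop K n : clear implicits.
Arguments Fop K n : clear implicits.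
Arguments Sop K n : clear implicits.

(* Main.v *)
(** The value of (x)_p [x+1]_(n-p) at an integer m is n! binom(m+n-p, n), whose
    generating series is n! x^p / (1-x)^(n+1); hence U_n maps this polynomial to
    x^p, and S_n x^p is (1-x)^(2n+1) times the series with coefficients
    n! binom(m+n-p, n) binom(m+n, n).  Regrouping factorials, these are
    (n+p)! (n-p)! / n! times binom(m+n, n+p) binom(m+n-p, n-p), and Nanjundiah's
    identity expands this product as
    \sum_j binom(n, j-p) binom(n, n-j) binom(m-j+2n, 2n), the m-th coefficient of
    \sum_j binom(n, j-p) binom(n, n-j) x^j / (1-x)^(2n+1). *)
Require Import Defs.
From mathcomp Require Import all_boot all_order all_algebra.
From mathcomp Require Import complex reals.
Import Order.TTheory GRing.Theory Num.Theory.
Local Open Scope ring_scope.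
Local Open Scope complex_scope.

Lemma ffactnDr m k l : (m ^_ (k + l) = m ^_ k * (m - k) ^_ l)%N.
Proof.
elim: l => [|l IHl]; first by rewrite addn0 ffactn0 muln1.
by rewrite addnS !ffactnSr IHl mulnA subnDA.
Qed.

(** Multiplied by k! l!, both sides become the falling factorial [m ^_ (k + l)]. *)
Lemma trinomial_revision m k l :
  ('C(m, k + l) * 'C(k + l, k) = 'C(m, k) * 'C(m - k, l))%N.
Proof.
apply/eqP; rewrite -(@eqn_pmul2r (k`! * l`!)) ?muln_gt0 ?fact_gt0 //; apply/eqP.
rewrite [RHS]mulnACA !bin_ffact -ffactnDr -mulnA.
by have := bin_fact (leq_addr l k); rewrite addKn => ->; rewrite bin_ffact.
Qed.

(** Vandermonde after k is replaced by k + l. The guard [l <= k] matters: below l, the truncated k -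
    l would contribute spurious terms. *)
Lemma Vandermonde_shift a b l n : (l <= n)%N ->
  (\sum_(k < n.+1 | l <= k) 'C(a, k - l) * 'C(b, n - k) = 'C(a + b, n - l))%N.
Proof.
move=> ln; rewrite -binomial.Vandermonde.
rewrite -(big_mkord (leq l) (fun k => 'C(a, k - l) * 'C(b, n - k))%N).
rewrite -(big_mkord xpredT (fun k => 'C(a, k) * 'C(b, n - l - k))%N).
rewrite (big_cat_nat (n := l)) //=; last by rewrite leqW.
rewrite big_nat_cond big_pred0 ?add0n => [|k]; last by rewrite ltnNge; case: (leq l k); rewrite ?andbF.
rewrite -{1}(add0n l) big_addn -subSn // big_mkcond /=.
by apply: eq_bigr => k _; rewrite leq_addl addnK subnDA subnAC.
Qed.

(** Expand binom(r+k, m+n) over l by Vandermonde and rewrite binom(a,k) binom(k,l) as binom(a,l)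
    binom(a-l,k-l). The sum over k is then binom(m+n-l, m); a second trinomial revision extracts
    binom(r,m), and Vandermonde sums over l. *)
Lemma Nanjundiah (a b m n r : nat) : (a + b = m + n)%N ->
  (\sum_(k < n.+1) 'C(a, k) * 'C(b, n - k) * 'C(r + k, m + n) =
   'C(r, m) * 'C(a + (r - m), n))%N.
Proof.
move=> abE.
transitivity (\sum_(k < n.+1) \sum_(l < n.+1 | l <= k)
    'C(r, m + n - l) * 'C(a, l) * ('C(a - l, k - l) * 'C(b, n - k)))%N.
  apply: eq_bigr => k _.
  have -> : ('C(r + k, m + n) =
      \sum_(l < n.+1 | l <= k) 'C(k, l) * 'C(r, m + n - l))%N.
    rewrite addnC -binomial.Vandermonde.
    rewrite (big_ord_widen_cond (m + n).+1 (fun l => l <= k)%N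
      (fun l => 'C(k, l) * 'C(r, m + n - l))%N) ?ltnS ?leq_addl //.
    rewrite [RHS]big_mkcond; apply: eq_bigr => l _ /=.
    have [lk|kl] := leqP l k; last by rewrite bin_small.
    by rewrite (leq_trans (n := k.+1)).
  rewrite big_distrr; apply: eq_bigr => l lk /=.
  have := trinomial_revision a l (k - l); rewrite subnKC // => akl.
  by rewrite mulnACA akl -!mulnA [RHS]mulnC -!mulnA.
rewrite (exchange_big_dep xpredT) //= -binomial.Vandermonde big_distrr.
apply: eq_bigr => l _ /=; have ln : (l <= n)%N by rewrite -ltnS.
rewrite -big_distrr /= Vandermonde_shift //.
(* Only for l <= a is (a - l) + b equal to m + n - l; otherwise binom(a,l) kills the term. *)
have [la|al] := leqP l a; last by rewrite (bin_small al) muln0 mul0n muln0.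
rewrite addnBAC // abE -(bin_sub (m := n - l)); last by rewrite leq_sub2r ?leq_addl.
rewrite -addnBA // addnK mulnAC trinomial_revision.
by rewrite -mulnA [X in (_ * X)%N]mulnC.
Qed.

Lemma bin_shift_sum n p j : (p <= n)%N ->
  (\sum_(p <= m < n.+1) 'C(n, m - p) * 'C(n, n - m) * 'C(j + 2 * n - m, 2 * n) =
   'C(j + n, n + p) * 'C(n + (j + n - (n + p)), n - p))%N.
Proof.
(* Nanjundiah with parameters a = b = n, m = n+p, n-p for n and r = j+n; its index is k = n - m in
   terms of the present m. *)
move=> pn; rewrite -(@Nanjundiah n n) -?addnA ?subnKC // big_nat_rev /=.
rewrite -[X in (\sum_(X <= _ < _) _)%N]add0n big_addn subSn // big_mkord.
apply: eq_bigr => k _; have kn : (k <= n - p)%N by rewrite -ltnS.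
have kn' : (k <= n)%N := leq_trans kn (leq_subr _ _).
rewrite addnS [(k + p)%N]addnC subSS subnDl subKn // mul2n -addnn.
rewrite addnA -addnBA ?leq_subr // subKn //; congr (_ * _)%N.
by rewrite mulnC subnAC.
Qed.

(** For j < p both sides vanish; otherwise both equal (j+n)_n (j+n-p)_(n-p) (j)_p. *)
Lemma ffact_bin_regroup n p j : (p <= n)%N ->
  ((j + n - p) ^_ n * 'C(j + n, n) * n`! =
   (n + p)`! * (n - p)`! * ('C(j + n, n + p) * 'C(n + (j + n - (n + p)), n - p)))%N.
Proof.
move=> pn; have [jp|pj] := ltnP j p.
  rewrite ffact_small ?(bin_small (m := n + p)) ?mul0n ?muln0 //.
    by rewrite addnC ltn_add2l.
  by rewrite ltn_subLR ?ltn_add2r // (leq_trans pn) ?leq_addl.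
have -> : (n + (j + n - (n + p)) = j + n - p)%N.
  by rewrite [(j + n)%N]addnC subnDl addnBA.
rewrite [RHS]mulnC mulnACA !bin_ffact -mulnA bin_ffact mulnC.
rewrite ffactnDr addnK -mulnA; congr (_ * _)%N.
rewrite -[X in (_ ^_ X)%N = _](subnK pn) ffactnDr mulnC; congr (_ * _ ^_ _)%N.
by rewrite subnAC -addnBA ?leq_subr // subKn // addnK.
Qed.

Section NegativeBinomial.
Variable K : comNzRingType.
Implicit Types q : {poly K}.

(* Coefficients of 1 / (1-x)^(d+1), see [pmul_negbin]. *)
Definition negbin d (m : nat) : K := 'C(m + d, d)%:R.

Lemma pmul_negbin d j : pmul ((1 - 'X) ^+ d.+1) (negbin d) j = (j == 0)%:R.
Proof.
elim: d j => [|d IHd] j.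
  case: j => [|j]; last by rewrite expr1 pmulBX /negbin !bin0 subrr.
  by rewrite /pmul big_ord1 expr1 coefB coef1 coefX subr0 mul1r /negbin bin0.
(* By Pascal's rule, one factor 1 - x turns [negbin d.+1] into [negbin d]. *)
rewrite exprSr pmulA -IHd; apply: eq_pmul => -[|i] _.
  by rewrite /pmul big_ord1 coefB coef1 coefX subr0 mul1r /negbin !add0n !binn.
by rewrite pmulBX /negbin addSn binS natrD addrAC subrr add0r addSnnS.
Qed.

(** Presents any polynomial as (1-x)^(d+1) times a series, so that identities between images of
    operators can be checked on series coefficients. *)
Lemma pmul_negbinK q d i : pmul ((1 - 'X) ^+ d.+1) (pmul q (negbin d)) i = q`_i.
Proof.
rewrite -pmulA mulrC pmulA.
rewrite (@eq_pmul _ _ _ (fun j => (j == 0)%:R)) => [|j _]; last first.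
  exact: pmul_negbin.
rewrite /pmul big_ord_recr /= subnn mulr1 big1 ?add0r // => k _.
by rewrite subn_eq0 leqNgt ltn_ord mulr0.
Qed.

Lemma pmulZ a q (f : nat -> K) i : pmul (a *: q) f i = a * pmul q f i.
Proof.
by rewrite /pmul mulr_sumr; apply: eq_bigr => k _; rewrite coefZ mulrA.
Qed.

Lemma pmul_sum I (r : seq I) (F : I -> {poly K}) (f : nat -> K) i :
  pmul (\sum_(m <- r) F m) f i = \sum_(m <- r) pmul (F m) f i.
Proof.
rewrite /pmul exchange_big; apply: eq_bigr => k _ /=.
by rewrite coef_sum mulr_suml.
Qed.

(* The numerator i + d - k does not underflow as k <= d, and the binomial vanishes
   for i < k. *)
Lemma pmulXn_negbin d k i : (k <= d)%N -> pmul 'X^k (negbin d) i = 'C(i + d - k, d)%:R.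
Proof.
move=> kd; have [ki|ik] := leqP k i.
  by rewrite -{1}(subnK ki) pmulXn /negbin addnBAC.
by rewrite pmulXn_lt // bin_small // ltn_subLR ?ltn_add2r // (leq_trans kd) ?leq_addl.
Qed.

End NegativeBinomial.

Section OperatorValues.
Variable K : numFieldType.

Lemma FopE n (q : {poly_n.+1 K}) i :
  (Fop K n q)`_i =
  pmul ((1 - 'X) ^+ (2 * n).+1) (fun m => q.[m%:R] * 'C(m + n, n)%:R) i.
Proof.
rewrite /Fop monomial_linE coefn_sum.
transitivity (\sum_(p < n.+1) q`_p *
    pmul ((1 - 'X) ^+ (2 * n).+1) (fun m => m%:R ^+ p * 'C(m + n, n)%:R) i).
  by apply: eq_bigr => p _; rewrite coefZ -FopX /Fop monomial_linX.
rewrite /pmul; under eq_bigr => p _ do rewrite mulr_sumr.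
rewrite exchange_big /=; apply: eq_bigr => j _.
rewrite (horner_coef_wide _ (size_npoly q)) mulr_suml mulr_sumr.
by apply: eq_bigr => p _; rewrite mulrCA -!mulrA.
Qed.

(** This is (x)_p [x+1]_(n-p), written through its roots; for p <= n its degree is n, so [npolyp]
    cuts nothing off. *)
Definition Uinv n p : {poly_n.+1 K} :=
  npolyp n.+1 (\prod_(k < p) ('X - k%:R%:P) *
               \prod_(k < n - p) ('X - (- k.+1%:R)%:P)).

Lemma prod_sub_ffact p j : \prod_(k < p) (j%:R - k%:R : K) = (j ^_ p)%:R.
Proof.
have [jp|pj] := ltnP j p.
  by rewrite ffact_small // (bigD1 (Ordinal jp)) //= subrr mul0r.
rewrite ffact_prod natr_prod; apply: eq_bigr => k _.
by rewrite natrB // (leq_trans _ pj) // ltnW.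
Qed.

Lemma prod_add_ffact p j : \prod_(k < p) (j%:R + k.+1%:R : K) = ((j + p) ^_ p)%:R.
Proof.
rewrite ffact_prod natr_prod (reindex_inj rev_ord_inj) /=.
by apply: eq_bigr => k _; rewrite -natrD subnSK // addnBA // ltnW.
Qed.

(** The roots are the n consecutive integers from -(n-p) to p-1, so the value at j is a single
    falling factorial starting at j+n-p. *)
Lemma horner_Uinv n p j : (p <= n)%N ->
  (Uinv n p).[j%:R] = ((j + n - p) ^_ n)%:R.
Proof.
move=> pn; rewrite npolypK; last first.
  apply: (leq_trans (size_polyMleq _ _)).
  rewrite !size_prod_XsubC -![index_enum _]enumT !size_enum_ord addSn addnS /=.
  by rewrite subnKC.
rewrite hornerM !horner_prod.
under eq_bigr => k _ do rewrite hornerXsubC.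
under [X in _ * X]eq_bigr => k _ do rewrite hornerXsubC opprK.
rewrite prod_sub_ffact prod_add_ffact -natrM mulnC addnBA //.
rewrite -[X in (_ ^_ X)%:R](subnK pn) ffactnDr.
by rewrite -addnBA // addnK.
Qed.

Lemma Uop_Uinv n (p : 'I_n.+1) : Uop K n (Uinv n p) = tnth (npolyX K n.+1) p.
Proof.
have pn : (p <= n)%N by rewrite -ltnS.
apply/val_inj/polyP => i /=; rewrite UopE npolyXE.
rewrite -[RHS](@pmul_negbinK K 'X^p n) {1 2}/pmul mulr_sumr; apply: eq_bigr => k _.
rewrite mulrCA; congr (_ * _); rewrite pmulXn_negbin // horner_Uinv //.
by rewrite -bin_ffact natrM mulrC mulfK // pnatr_eq0 -lt0n fact_gt0.
Qed.

Lemma Sop_monomial n (p : 'I_n.+1) : Sop K n (tnth (npolyX K n.+1) p) =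
  (((n + p)`! * (n - p)`!)%N%:R / n`!%:R) *:
      \sum_(p <= m < n.+1) ('C(n, m - p) * 'C(n, n - m))%N%:R *: 'X^m
  :> {poly K}.
Proof.
have pn : (p <= n)%N by rewrite -ltnS.
(* Writing x^p as the image of [Uinv n p] under U_n lets the inverse cancel, as U_n has trivial
   kernel. *)
rewrite /Sop comp_lfunE -Uop_Uinv lker0_lfunK ?lker_Uop //.
apply/polyP => i; rewrite FopE -[RHS](@pmul_negbinK K _ (2 * n)).
apply: eq_pmul => j _.
rewrite pmulZ pmul_sum horner_Uinv //.
under eq_big_nat => m /andP[_ mn].
  rewrite pmulZ pmulXn_negbin; last by rewrite mul2n -addnn (leq_trans (n := n)) ?leq_addr.
  rewrite -natrM; over.
rewrite -natr_sum bin_shift_sum // mulrAC -!natrM -ffact_bin_regroup //.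
by rewrite [in RHS]natrM mulfK // pnatr_eq0 -lt0n fact_gt0.
Qed.

End OperatorValues.

Theorem theorem13 (R : realType) (n : nat) (p : 'I_n.+1) :
  Sop R[i] n (tnth (npolyX R[i] n.+1) p) =
    (((n + p)`! * (n - p)`!)%N%:R / n`!%:R) *:
      \sum_(p <= m < n.+1) ('C(n, m - p) * 'C(n, n - m))%N%:R *: 'X^m
  :> {poly R[i]}.
Proof. exact: Sop_monomial. Qed.
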